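(* If $(E,\|\cdot\|_{\mathbf{u}})$ is complete and separable, then $\mathsf{MPCC}_{\mathbf{u}}(E)$, the hyperspace of nonempty compact max-plus convex subsets of $E$, is an absolute retract.
   Context: $E\neq\{0\}$ is an Archimedean Riesz space (real vector lattice; Archimedean means that if $ny\leqslant x$ for all $n\in\mathbb{N}$ then $y\leqslant 0$), and $\mathbf{u}\in E_+$ is a unit: for every $x\in E_+$ there is $n\in\mathbb{N}$ with $x\leqslant n\mathbf{u}$. $\|x\|_{\mathbf{u}}=\inf\{t\ge0:|x|\leqslant t\mathbf{u}\}$, a norm on $E$. The topology on $E$ is that of $\|\cdot\|_{\mathbf{u}}$, or equivalently that of the metric $\mathsf{D}_{\mathbf{hu}}(x,y)=\max\{0,\mathbf{p}_{\mathbf{u}}(x-y)\}+\max\{0,\mathbf{p}_{\mathbf{u}}(y-x)\}$, where $\mathbf{p}_{\mathbf{u}}(x)=\inf\{t\in\mathbb{R}:x\leqslant t\mathbf{u}\}$. The max-plus convex hull of a nonempty $S\subset E$ is the set $[\![S]\!]$ of all elements $(x_1+t_1\mathbf{u})\vee\cdots\vee(x_m+t_m\mathbf{u})$ with $m\ge1$, $x_i\in S$, $t_i\in\mathbb{R}$ and $\max_i t_i=0$; $[\![\emptyset]\!]=\emptyset$. A set $C\subset E$ is max-plus convex if $C=[\![C]\!]$. $\mathsf{MPCC}_{\mathbf{u}}(E)$ carries the topology of the Hausdorff metric associated to $\mathsf{D}_{\mathbf{hu}}$ (equivalently, to $\|\cdot\|_{\mathbf{u}}$). An absolute retract is a metrizable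 space that is a retract of every metrizable space containing it as a closed subspace. *)

(* Defs.v *)
From HB Require Import structures.
From mathcomp Require Import all_boot all_order all_algebra.
From mathcomp Require Import all_classical all_reals all_analysis.

Set Implicit Arguments.
Unset Strict Implicit.
Unset Printing Implicit Defensive.

Import Order.TTheory GRing.Theory Num.Theory.
Import numFieldNormedType.Exports.

Local Open Scope classical_set_scope.
Local Open Scope ring_scope.

#[short(type="porderLmodType")]
HB.structure Definition POrderedLmodule (R : numDomainType) :=
  { E of GRing.Lmodule R E & Order.POrder ring_display E }.

(* [Order.Lattice] cannot be combined with [GRing.Lmodule]: the join of the two
   hierarchies would have to lie below [Num.RealDomain], already declared. *)
HB.mixin Record POrderedLmodule_isRiesz (R : numDomainType) E
    of POrderedLmodule R E := {
  riesz_leD2r : forall z x y : E, x <= y -> x + z <= y + z ;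
  riesz_scale_ge0 : forall (a : R) (x : E), 0 <= a -> 0 <= x -> 0 <= a *: x ;
  rjoin : E -> E -> E ;
  rmeet : E -> E -> E ;
  rjoin_le : forall x y z : E, (rjoin x y <= z) = (x <= z) && (y <= z) ;
  le_rmeet : forall x y z : E, (z <= rmeet x y) = (z <= x) && (z <= y)
}.

#[short(type="rieszType")]
HB.structure Definition Riesz (R : numDomainType) :=
  { E of POrderedLmodule R E & POrderedLmodule_isRiesz R E }.

Section riesz.
Context {R : realType} {E : rieszType R}.
Implicit Types (x y z u : E) (S C : set E).

Definition archimedean : Prop :=
  forall x y, (forall n : nat, y *+ n <= x) -> y <= 0.

Definition riesz_unit u : Prop :=
  0 <= u /\ forall x, 0 <= x -> exists n : nat, x <= u *+ n.

Definition riesz_abs x : E := rjoin x (- x).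

Definition unorm u x : R := inf [set t : R | 0 <= t /\ riesz_abs x <= t *: u].

(* A join has no neutral element here: as the big operators need one, the term
   of index 0 is repeated, which idempotence makes harmless. *)
Definition mp_hull u S : set E :=
  [set z | exists (m : nat) (x : 'I_m.+1 -> E) (t : 'I_m.+1 -> R),
     [/\ forall i, S (x i),
         \big[Num.max/t ord0]_(i < m.+1) t i = 0
       & z = \big[rjoin/x ord0 + t ord0 *: u]_(i < m.+1)
               (x i + t i *: u)]].

Definition mp_convex u C : Prop := C = mp_hull u C.

End riesz.
Arguments archimedean {R} E.

Section unorm_theory.
Context {R : realType} {E : rieszType R} {u : E}.
Hypotheses (archE : archimedean E) (unit_u : riesz_unit u).
Implicit Types x y : E.

Lemma le_rjoinl x y : x <= rjoin x y.
Proof. by have := rjoin_le x y (rjoin x y); rewrite lexx => /esym/andP[]. Qed.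

Lemma le_rjoinr x y : y <= rjoin x y.
Proof. by have := rjoin_le x y (rjoin x y); rewrite lexx => /esym/andP[]. Qed.

Lemma riesz_leB x y : (x <= y) = (0 <= y - x).
Proof.
apply/idP/idP => [xy|yx].
  by have := riesz_leD2r (- x) _ _ xy; rewrite subrr.
by have := riesz_leD2r x _ _ yx; rewrite add0r subrK.
Qed.

Lemma riesz_leD x y z w : x <= y -> z <= w -> x + z <= y + w.
Proof.
move=> xy zw; apply: le_trans (riesz_leD2r z _ _ xy) _.
by rewrite ![y + _]addrC; exact: riesz_leD2r.
Qed.

Lemma riesz_le_scale (a : R) x y : 0 <= a -> x <= y -> a *: x <= a *: y.
Proof.
move=> a0; rewrite riesz_leB => xy.
by rewrite riesz_leB -scalerBr; exact: riesz_scale_ge0.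
Qed.

Lemma riesz_abs_le x y : (riesz_abs x <= y) = (x <= y) && (- x <= y).
Proof. exact: rjoin_le. Qed.

Let dom x : set R := [set t | 0 <= t /\ riesz_abs x <= t *: u].

Lemma unorm_has_inf x : has_inf (dom x).
Proof.
case: unit_u => u0 uE; split; last by exists 0 => t [].
have /uE[n nP] : 0 <= (rjoin x 0 + rjoin (- x) 0 : E).
  by rewrite -[leLHS]addr0; apply: riesz_leD; rewrite le_rjoinr.
exists n%:R; split => //; rewrite scaler_nat riesz_abs_le.
apply/andP; split; apply: le_trans nP.
  by rewrite -[leLHS]addr0; apply: riesz_leD; rewrite ?le_rjoinl ?le_rjoinr.
by rewrite -[leLHS]add0r; apply: riesz_leD; rewrite ?le_rjoinl ?le_rjoinr.
Qed.

Lemma unorm_ge0 x : 0 <= unorm u x.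
Proof. by apply: lb_le_inf => [|t []//]; case: (unorm_has_inf x). Qed.

Lemma unorm_le x (t : R) : 0 <= t -> riesz_abs x <= t *: u -> unorm u x <= t.
Proof.
by move=> t0 xt; apply: ge_inf => //; case: (unorm_has_inf x).
Qed.

Lemma unorm_lt x (e : R) : unorm u x < e -> riesz_abs x <= e *: u.
Proof.
move=> xe; have [t [t0 xt] te] : exists2 t, dom x t & t < e.
  by apply: inf_lt => //; case: (unorm_has_inf x).
apply: le_trans xt _; rewrite riesz_leB -scalerBl riesz_scale_ge0//.
  by rewrite subr_ge0 ltW.
by case: unit_u.
Qed.

Lemma unorm_triangle x y : unorm u (x + y) <= unorm u x + unorm u y.
Proof.
apply/ler_addgt0Pr => e e0.
have e20 : 0 < e / 2 by rewrite divr_gt0.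
have h z : riesz_abs z <= (unorm u z + e / 2) *: u.
  by apply: unorm_lt; rewrite ltrDl.
have := h x; have := h y; rewrite !riesz_abs_le => /andP[y1 y2] /andP[x1 x2].
rewrite [e in leRHS]splitr addrACA; apply: unorm_le.
  by rewrite !addr_ge0 ?unorm_ge0// ltW.
by rewrite riesz_abs_le scalerDl opprD !riesz_leD.
Qed.

Let unormZ_le (l : R) x : unorm u (l *: x) <= `|l| * unorm u x.
Proof.
apply/ler_addgt0Pr => e e0.
pose d := e / (`|l| + 1); have l1 : 0 < `|l| + 1 by rewrite ltr_wpDl.
have d0 : 0 < d by rewrite divr_gt0.
apply: (@le_trans _ _ (`|l| * (unorm u x + d))); last first.
  rewrite mulrDr lerD2l /d mulrCA -[leRHS]mulr1 ler_pM2l//.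
  by rewrite ler_pdivrMr// mul1r lerDl.
have /unorm_lt : unorm u x < unorm u x + d by rewrite ltrDl.
rewrite riesz_abs_le => /andP[x1 x2].
apply: unorm_le.
  by rewrite mulr_ge0// addr_ge0 ?unorm_ge0// ltW.
rewrite riesz_abs_le -!scalerA; have [l0|l0] := leP 0 l.
  rewrite ger0_norm// -scalerN; apply/andP.
  by split; apply: riesz_le_scale.
rewrite ltr0_norm//.
have -> : l *: x = - l *: - x by rewrite scalerN scaleNr opprK.
rewrite -scalerN opprK.
have nl0 : 0 <= - l by rewrite oppr_ge0 ltW.
by apply/andP; split; apply: riesz_le_scale.
Qed.

Lemma unormZ (l : R) x : unorm u (l *: x) = `|l| * unorm u x.
Proof.
have [->|l0] := eqVneq l 0.
  by apply/eqP; rewrite normr0 mul0r eq_le unorm_ge0 andbT;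
    have := unormZ_le 0 x; rewrite normr0 mul0r.
apply/eqP; rewrite eq_le unormZ_le/=.
have := unormZ_le l^-1 (l *: x).
by rewrite scalerA mulVf// scale1r normfV ler_pdivlMl ?normr_gt0.
Qed.

Lemma unorm_eq0 x : unorm u x = 0 -> x = 0.
Proof.
move=> x0.
have h y : y <= riesz_abs x -> y <= 0.
  move=> yx; apply: (archE (x := u)) => -[|n]; first by case: unit_u.
  have /unorm_lt xn : unorm u x < n.+1%:R^-1 by rewrite x0 invr_gt0.
  have := riesz_le_scale (ler0n R n.+1) (le_trans yx xn).
  by rewrite scalerA mulfV ?pnatr_eq0// scale1r scaler_nat.
have x1 : x <= 0 by apply: h; exact: le_rjoinl.
have x2 : - x <= 0 by apply: h; exact: le_rjoinr.
by rewrite riesz_leB sub0r opprK in x2; apply: le_anti; rewrite x1.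
Qed.

End unorm_theory.

(* The Riesz space [E] with the topology of [unorm u]; the proofs are arguments
   because they are what makes [unorm u] a norm. *)
Definition unorm_space (R : realType) (E : rieszType R) (u : E)
  (archE : archimedean E) (unit_u : riesz_unit u) : Type := E.

Section unorm_space.
Context {R : realType} {E : rieszType R} {u : E}.
Context {archE : archimedean E} {unit_u : riesz_unit u}.
Local Notation Eu := (unorm_space archE unit_u).

HB.instance Definition _ := Riesz.copy Eu E.
HB.instance Definition _ := Lmodule_isNormed.Build R Eu
  (unorm_triangle unit_u) (unormZ unit_u) (unorm_eq0 archE unit_u).

Let dist (x y : Eu) : R := `|x - y|.

Let dist_ge0 x y : 0 <= dist x y.
Proof. exact: normr_ge0. Qed.

Let dist_positivity x y : dist x y = 0 -> x = y.
Proof. by move/normr0_eq0/eqP; rewrite subr_eq0 => /eqP. Qed.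

Let ballEdist (x : Eu) (d : R) : ball x d = [set y | dist x y < d].
Proof. by rewrite -ball_normE. Qed.

HB.instance Definition _ :=
  PseudoMetric_isMetric.Build R Eu dist_ge0 dist_positivity ballEdist.

End unorm_space.

Definition hausdorff_dist {R : realType} {M : metricType R} (A B : set M) : R :=
  inf [set e : R | [/\ 0 <= e,
    forall a, A a -> exists2 b, B b & mdist a b <= e
  & forall b, B b -> exists2 a, A a & mdist a b <= e]].

Record compacts (R : realType) (M : metricType R) := Compacts {
  compacts_set :> set M ;
  compacts_compact : compact compacts_set ;
  compacts_neq0 : compacts_set !=set0 }.

Section compacts.
Context {R : realType} {M : metricType R}.
Implicit Types A B C : compacts M.

HB.instance Definition _ := gen_eqMixin (compacts M).
HB.instance Definition _ := gen_choiceMixin (compacts M).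

Lemma compacts_inj A B : compacts_set A = compacts_set B -> A = B.
Proof.
case: A B => [A cA A0] [B cB B0] /= AB; subst B.
by congr Compacts; exact: Prop_irrelevance.
Qed.

Let D A B : set R := [set e : R | [/\ 0 <= e,
    forall a, compacts_set A a -> exists2 b, compacts_set B b & mdist a b <= e
  & forall b, compacts_set B b -> exists2 a, compacts_set A a & mdist a b <= e]].

Let HE A B : hausdorff_dist (compacts_set A) (compacts_set B) = inf (D A B).
Proof. by []. Qed.

Let compacts_bounded A (x : M) :
  exists2 r : R, 0 <= r & forall a, compacts_set A a -> mdist x a <= r.
Proof.
have [r rP] : exists r : R, forall a, compacts_set A a -> mdist x a <= r.
  have /compact_near_coveringP/(_ R +oo%R
      (fun r a => mdist x a <= r) _) := compacts_compact (c := A).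
  move=> h; have : \forall r \near +oo%R,
      compacts_set A `<=` (fun a => mdist x a <= r).
    apply: h => a Aa; exists (ball a 1, [set r | mdist x a + 1 < r]).
      split => /=; first exact: nbhsx_ballx.
      by apply: nbhs_pinfty_gt; exact: num_real.
    move=> [b r]/= []; rewrite ballEmdist/= => ab ar.
    apply: le_trans (metric_triangle x a b) _.
    by rewrite (le_trans _ (ltW ar))// lerD2l ltW.
  by move/filter_ex => [r rP]; exists r.
exists (Num.max 0 r); first by rewrite le_max lexx.
by move=> a /rP ar; rewrite le_max ar orbT.
Qed.

Let D_has_inf A B : has_inf (D A B).
Proof.
split; last by exists 0 => e [].
have [a Aa] := compacts_neq0 A; have [b Bb] := compacts_neq0 B.
have [r r0 rP] := compacts_bounded A b; have [s s0 sP] := compacts_bounded B a.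
exists (r + s); split; first exact: addr_ge0.
  by move=> x /rP xr; exists b => //; rewrite metric_sym ler_wpDr.
by move=> y /sP ys; exists a => //; rewrite ler_wpDl.
Qed.

Let D_gt A B (e : R) : hausdorff_dist (compacts_set A) (compacts_set B) < e ->
  exists2 d, d < e & D A B d.
Proof.
rewrite HE => /(inf_lt (D_has_inf A B).1)[d Dd de].
by exists d.
Qed.

Let H_ge0 A B : 0 <= hausdorff_dist (compacts_set A) (compacts_set B).
Proof. by apply: lb_le_inf => [|t []//]; case: (D_has_inf A B). Qed.

Let H_le A B (e : R) : D A B e ->
  hausdorff_dist (compacts_set A) (compacts_set B) <= e.
Proof. by move=> De; apply: ge_inf => //; case: (D_has_inf A B). Qed.

Lemma hausdorff_distxx A : hausdorff_dist (compacts_set A) (compacts_set A) = 0.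
Proof.
apply/eqP; rewrite eq_le H_ge0 andbT; apply: H_le.
by split => // a Aa; exists a; rewrite ?mdistxx.
Qed.

Lemma hausdorff_dist_sym A B :
  hausdorff_dist (compacts_set A) (compacts_set B) =
  hausdorff_dist (compacts_set B) (compacts_set A).
Proof.
rewrite !HE; congr inf; apply/seteqP; split=> e [e0 h1 h2]; split=> //.
- by move=> b /h2[a Aa ab]; exists a; rewrite 1?metric_sym.
- by move=> b /h1[a Aa ab]; exists a; rewrite 1?metric_sym.
- by move=> b /h2[a Aa ab]; exists a; rewrite 1?metric_sym.
- by move=> b /h1[a Aa ab]; exists a; rewrite 1?metric_sym.
Qed.

Lemma hausdorff_dist_triangle B A C :
  hausdorff_dist (compacts_set A) (compacts_set C) <=
  hausdorff_dist (compacts_set A) (compacts_set B) +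
  hausdorff_dist (compacts_set B) (compacts_set C).
Proof.
apply/ler_addgt0Pr => e e0; have e20 : 0 < e / 2 by rewrite divr_gt0.
have /D_gt[d1 + [d10 AB BA]] : hausdorff_dist (compacts_set A) (compacts_set B)
    < hausdorff_dist (compacts_set A) (compacts_set B) + e / 2.
  by rewrite ltrDl.
have /D_gt[d2 + [d20 BC CB]] : hausdorff_dist (compacts_set B) (compacts_set C)
    < hausdorff_dist (compacts_set B) (compacts_set C) + e / 2.
  by rewrite ltrDl.
move=> /ltW h2 /ltW h1; rewrite [e in leRHS]splitr addrACA.
apply: le_trans (lerD h1 h2); apply: H_le; split; first exact: addr_ge0.
  move=> a /AB[b /BC[c Cc bc] ab]; exists c => //.
  exact: le_trans (metric_triangle a b c) (lerD ab bc).
move=> c /CB[b /BA[a Aa ab] bc]; exists a => //.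
exact: le_trans (metric_triangle a b c) (lerD ab bc).
Qed.

Lemma hausdorff_dist_positivity A B :
  hausdorff_dist (compacts_set A) (compacts_set B) = 0 -> A = B.
Proof.
suff sub A' B' : hausdorff_dist (compacts_set A') (compacts_set B') = 0 ->
    compacts_set A' `<=` compacts_set B'.
  move=> AB; apply/compacts_inj/seteqP; split; apply: sub => //.
  by rewrite hausdorff_dist_sym.
move=> AB0 a Aa.
have /(@closure_id _ _)-> :=
  compact_closed (@metric_hausdorff R M) (compacts_compact (c := B')).
move=> U; rewrite -filter_from_ballE => -[e /= e0 eU].
have /D_gt[d de [d0 + _]] : hausdorff_dist (compacts_set A') (compacts_set B') < e.
  by rewrite AB0.
move=> /(_ _ Aa)[b Bb ab]; exists b; split => //.
by apply: eU; rewrite ballEmdist/= (le_lt_trans ab).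
Qed.

HB.instance Definition _ := isMetric.Build R (compacts M)
  hausdorff_distxx hausdorff_dist_positivity hausdorff_dist_sym
  hausdorff_dist_triangle.

End compacts.

(* A set of [compacts _] is turned into a topological space by the coercion of
   sets to types: it has the subspace topology. *)
Definition MPCC {R : realType} {E : rieszType R} (u : E)
    (archE : archimedean E) (unit_u : riesz_unit u) :
    set (compacts (unorm_space archE unit_u)) :=
  [set C : compacts (unorm_space archE unit_u) | mp_convex u (C : set E)].
Arguments MPCC {R E u} archE unit_u.

Definition complete_space (T : puniformType) : Prop :=
  forall F : set_system T, ProperFilter F -> cauchy F -> cvg F.

Definition separable (T : topologicalType) : Prop :=
  exists2 D : set T, countable D & dense D.

Definition metrizable (R : realType) (X : topologicalType) : Prop :=
  exists d : X -> X -> R,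
    [/\ forall x y, d x y = 0 <-> x = y,
        forall x y, d x y = d y x,
        forall x y z, d x z <= d x y + d y z
      & forall x (A : set X), nbhs x A <->
          exists2 e : R, 0 < e & [set y | d x y < e] `<=` A].

Definition closed_embedding (X Y : topologicalType) (i : X -> Y) : Prop :=
  [/\ injective i,
      forall U : set X, open U <-> exists2 V : set Y, open V & U = i @^-1` V
    & closed (range i)].

Definition retract_of (Y : topologicalType) (A : set Y) : Prop :=
  exists r : Y -> Y,
    [/\ continuous r, range r `<=` A & forall y, A y -> r y = y].

(* The closed subspaces of [Y] that are copies of [X] are the ranges of the
   closed embeddings of [X] into [Y]. *)
Definition absolute_retract (R : realType) (X : topologicalType) : Prop :=
  metrizable R X /\
  forall (Y : topologicalType) (i : X -> Y),
    metrizable R Y -> closed_embedding i -> retract_of (range i).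

(* Main.v *)
Require Import Defs.
From HB Require Import structures.
From mathcomp Require Import all_boot all_order all_algebra.
From mathcomp Require Import all_classical all_reals all_analysis.
From mathcomp Require Import ring lra.

Set Implicit Arguments.
Unset Strict Implicit.
Unset Printing Implicit Defensive.

Import Order.TTheory GRing.Theory Num.Theory.
Import numFieldNormedType.Exports.
Local Open Scope classical_set_scope.
Local Open Scope ring_scope.

(** The hyperspace of nonempty compact max-plus convex sets carries a continuous
two-point mixing operation under which every ball is stable, and a nonempty
separable metric space with such an operation is an absolute retract.

The operation is a weighted join. For sets [C] and [D] and weights [s], [t],
the set of all [(x + s u) v (y + t u)] with [x] in [C] and [y] in [D] is the
continuous image of a compact product, and it is max-plus convex because a
max-plus combination of such joins is the join of a combination in [C] and one
in [D] ([mp_convex_image_mix]). Adding multiples of [u] and taking joins are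
nonexpansive for the norm of [u], so the result depends continuously on [C],
[D] and the weights ([hyper_mix_dist]). If moreover [max(s, t) = 0], mixing a
convex set [B] with itself gives [B] back; by nonexpansiveness, [C] and [D]
within [e] of [B] mix to a set within [e] of [B] ([hyper_mix_ball]). A term
whose weight is below minus the largest distance between points of [C] and [D]
is absorbed by the other one, so letting the weights run between two such
extremes gives a path from [C] to [D] ([slide0], [slide1]).

For the retraction, let [X] be embedded by [i] as a closed subset of a metric
space [Y] and let [a] be a dense sequence of [X]. A point [y] off the range,
at distance [delta] from it, is sent to [a 0] mixed with [a 1] mixed with
[a 2] and so on, where the parameter of the [n]-th stage keeps only [a n] when
[y] is within [2 delta] of [i (a n)] and ignores [a n] beyond [3 delta]. This
is the stick-breaking version of the Dugundji extension: near [y] the process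
stops at a fixed stage, hence continuity off the range, and all the points
used lie within [3 delta] of [y], so that stability of balls gives continuity
at the points of the range. Density of a sequence replaces paracompactness.
The hyperspace has a dense sequence because a compact set is described up to
[e] by a finite set of indices of a dense sequence of the Riesz space
([compacts_dense_sequence]). *)

(** * Metrics inducing a topology, distance to the range of a map *)

(** The body of [metrizable], with the metric made a parameter. *)
Definition metrizes {R : realType} {Y : topologicalType} (d : Y -> Y -> R) :=
  [/\ forall x y, d x y = 0 <-> x = y,
      forall x y, d x y = d y x,
      forall x y z, d x z <= d x y + d y z
    & forall x (A : set Y), nbhs x A <->
        exists2 e : R, 0 < e & [set y | d x y < e] `<=` A].

Lemma metrizes_mdist {R : realType} (X : metricType R) :
  metrizes (@mdist R X).
Proof.
split=> [x y|x y|x y z|x A].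
- by split=> [/mdist_positivity//|->]; exact: mdistxx.
- exact: metric_sym.
- exact: metric_triangle.
- by rewrite -metricType_numDomainType.filter_from_mdist_nbhs.
Qed.

Section dist_to_range.
Context {R : realType} {X : Type} {Y : topologicalType}.
Variables (rho : Y -> Y -> R) (i : X -> Y) (x0 : X).
Hypothesis rhoP : metrizes rho.

Let rho0 y : rho y y = 0.
Proof. by case: rhoP => /(_ y y)[_ ->]. Qed.

Let rhoC y z : rho y z = rho z y. Proof. by case: rhoP. Qed.
Let rhoD y z w : rho y w <= rho y z + rho z w. Proof. by case: rhoP. Qed.

Lemma metrizes_ge0 y z : 0 <= rho y z.
Proof. by have := rhoD y z y; rewrite rho0 (rhoC z y); lra. Qed.

Lemma metrizes_near y (A : set Y) : nbhs y A <->
  exists2 e : R, 0 < e & [set z | rho y z < e] `<=` A.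
Proof. by case: rhoP. Qed.

Definition dist_range (y : Y) : R := inf (range (fun x => rho y (i x))).

Let dist_range_has_inf y : has_inf (range (fun x => rho y (i x))).
Proof.
split; first by exists (rho y (i x0)), x0.
by exists 0 => _ [x _ <-]; exact: metrizes_ge0.
Qed.

Lemma dist_range_le y x : dist_range y <= rho y (i x).
Proof. by apply: ge_inf; [case: (dist_range_has_inf y) | exists x]. Qed.

Lemma dist_range_lt y e : dist_range y < e -> exists x, rho y (i x) < e.
Proof.
by move=> /(inf_lt (dist_range_has_inf y).1)[_ [x _ <-]]; exists x.
Qed.

Lemma dist_range_gt0 y : closed (range i) -> ~ range i y -> 0 < dist_range y.
Proof.
move=> ci yi; have : nbhs y (~` range i).
  by apply: open_nbhs_nbhs; split=> //; exact: closed_openC.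
move=> /metrizes_near[e e0 ye]; rewrite ltNge; apply/negP => dy.
have /dist_range_lt[x] : dist_range y < e by lra.
by move=> /ye; apply; exists x.
Qed.

Lemma dist_rangeD y z : dist_range z <= dist_range y + rho y z.
Proof.
apply/ler_addgt0Pr => e e0.
have /dist_range_lt[x xe] : dist_range y < dist_range y + e by rewrite ltrDl.
have := dist_range_le z x; have := rhoD z y (i x); rewrite (rhoC z y); lra.
Qed.

Lemma metrizes_continuous (f : Y -> R) :
  (forall y z, f z <= f y + rho y z) -> continuous f.
Proof.
move=> fL y; apply/cvgrPdist_lt => e e0.
apply/metrizes_near; exists e => // z /= yz.
by rewrite ltr_norml; have := fL y z; have := fL z y; rewrite (rhoC z y); lra.
Qed.

Lemma dist_range_continuous : continuous dist_range.
Proof. exact: metrizes_continuous dist_rangeD. Qed.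

Lemma metrizes_dist_continuous z : continuous (fun y => rho y z).
Proof.
by apply: metrizes_continuous => y w; rewrite (rhoC y w) addrC; exact: rhoD.
Qed.

End dist_to_range.

(** * Stick-breaking retractions *)

Section stick_breaking.
Context {R : realType} {X : metricType R}.
Variables (a : nat -> X) (m : X -> X -> R -> X).
Hypothesis a_dense : forall x (e : R), 0 < e -> exists n, mdist (a n) x < e.
Hypothesis m_cont : continuous (fun q : X * X * R => m q.1.1 q.1.2 q.2).
Hypothesis m0 : forall x y, m x y 0 = x.
Hypothesis m1 : forall x y, m x y 1 = y.
Hypothesis m_ball : forall x y z p (e : R),
  mdist z x < e -> mdist z y < e -> mdist z (m x y p) < e.

Variables (Y : topologicalType) (i : X -> Y) (rho : Y -> Y -> R).
Hypotheses (rhoP : metrizes rho) (iP : closed_embedding i).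

Let delta := dist_range rho i.

(** The clamped affine function of the ratio is 1 up to 2 and 0 from 3 on. The
bound 2 is above 1, so that some [n] has weight 1; the bound 3 is finite, so
that only values of [a] whose image is close to [y] matter. *)
Definition stick_weight n y : R :=
  Num.max 0 (Num.min 1 (3 - rho y (i (a n)) / delta y)).

(** Stages are nested from the outside in: stage [k] mixes [a k] with the result
of the later stages, so a weight 1 at stage [k] makes these irrelevant. *)
Definition stick_fold n y : X :=
  foldr (fun k z => m z (a k) (stick_weight k y)) (a n) (iota 0 n).

Lemma stick_weight1 n y : 0 < delta y -> rho y (i (a n)) <= 2 * delta y ->
  stick_weight n y = 1.
Proof.
move=> d0 h; rewrite /stick_weight min_l ?max_r//.
have : rho y (i (a n)) / delta y <= 2 by rewrite ler_pdivrMr.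
lra.
Qed.

Lemma stick_weight0 n y : 0 < delta y -> 3 * delta y <= rho y (i (a n)) ->
  stick_weight n y = 0.
Proof.
move=> d0 h; rewrite /stick_weight max_l// ge_min; apply/orP; right.
have : 3 <= rho y (i (a n)) / delta y by rewrite ler_pdivlMr.
lra.
Qed.

Lemma stick_fold_stable n k y :
  stick_weight n y = 1 -> stick_fold (n + k) y = stick_fold n y.
Proof.
case: k => [|k] wn; first by rewrite addn0.
by rewrite /stick_fold iotaD foldr_cat /= add0n wn m1.
Qed.

Lemma stick_fold_eq n k y :
  stick_weight n y = 1 -> stick_weight k y = 1 ->
  stick_fold n y = stick_fold k y.
Proof.
move=> wn wk; case/orP: (leq_total n k) => [nk|kn].
  by rewrite -(subnKC nk) stick_fold_stable.
by rewrite -(subnKC kn) stick_fold_stable.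
Qed.

Lemma stick_weight_continuous n y : 0 < delta y ->
  {for y, continuous (stick_weight n)}.
Proof.
move=> d0.
apply: (@continuous_max _ _ (fun=> 0) (fun y => Num.min 1 _)).
  exact: cvg_cst.
apply: (@continuous_min _ _ (fun=> 1)).
  exact: cvg_cst.
apply: cvgB; first exact: cvg_cst.
apply: cvgM; first exact: metrizes_dist_continuous.
apply: cvgV; first by rewrite gt_eqF.
exact: (dist_range_continuous (a 0)).
Qed.

Lemma stick_fold_continuous n y : 0 < delta y ->
  {for y, continuous (stick_fold n)}.
Proof.
move=> d0; rewrite /stick_fold; elim: (iota 0 n) => [|k s IH] /=.
  exact: cvg_cst.
set f := fun z => foldr (fun k w => m w (a k) (stick_weight k z)) (a n) s.
have fc : (f z, a k, stick_weight k z) @[z --> y] -->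
    nbhs (f y, a k, stick_weight k y).
  apply: (@cvg_pair _ _ _ _ (nbhs (f y, a k)) (nbhs (stick_weight k y)));
    last exact: stick_weight_continuous.
  by apply: (@cvg_pair _ _ _ _ (nbhs (f y)) (nbhs (a k)));
    [exact: IH | exact: cvg_cst].
exact: (cvg_comp _ _ fc (@m_cont (f y, a k, stick_weight k y))).
Qed.

(** A stage of weight 0 changes nothing, and the other stages stay in the ball
by its stability under [m]. The weight of the last stage has to be positive
because [a n] is the innermost value. *)
Lemma stick_fold_ball n y x e : 0 < delta y ->
  (forall k, rho y (i (a k)) < 3 * delta y -> mdist x (a k) < e) ->
  stick_weight n y = 1 -> mdist x (stick_fold n y) < e.
Proof.
move=> d0 near w1.
have step k : stick_weight k y != 0 -> mdist x (a k) < e.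
  move=> wk; apply: near; rewrite ltNge; apply: contra_neqN wk.
  exact: stick_weight0.
rewrite /stick_fold; elim: (iota 0 n) => [|k s IH] /=.
  by apply: step; rewrite w1 oner_neq0.
have [->|/step ?] := eqVneq (stick_weight k y) 0; first by rewrite m0.
exact: m_ball.
Qed.

Lemma embedding_continuous : continuous i.
Proof.
by case: iP => _ iO _; apply/continuousP => V oV; apply/iO; exists V.
Qed.

Lemma embedding_inv x (e : R) : 0 < e -> exists2 h : R, 0 < h &
  forall z, rho (i x) (i z) < h -> mdist x z < e.
Proof.
move=> e0; case: iP => _ iO _.
have /iO[V oV VE] := @open_interior X (ball x e).
have Vx : V (i x).
  by have : (ball x e)^° x by [apply: nbhsx_ballx]; rewrite VE.
have /(metrizes_near rhoP)[h h0 hV] := open_nbhs_nbhs (conj oV Vx).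
exists h => // z /hV Vz.
have : (i @^-1` V) z by [].
by rewrite -VE => /interior_subset; rewrite ballEmdist.
Qed.

Lemma stick_stop y : ~ range i y -> exists n, rho y (i (a n)) < 2 * delta y.
Proof.
case: iP => _ _ ci yi; pose x0 : X := a 0.
have d0 : 0 < delta y by exact: dist_range_gt0.
have /(dist_range_lt x0 rhoP)[x xd] : dist_range rho i y < 2 * delta y.
  by rewrite -/delta; lra.
have := embedding_continuous (x := x).
have /(metrizes_near rhoP _ _).2 /[swap] /[apply] : exists2 e : R, 0 < e &
    [set z | rho (i x) z < e] `<=` [set z | rho y z < 2 * delta y].
  exists (2 * delta y - rho y (i x)) => [|z /= xz]; first by rewrite subr_gt0.
  by case: rhoP => _ _ /(_ y (i x) z) + _; lra.
rewrite nbhs_filterE -metricType_numDomainType.filter_from_mdist_nbhs.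
move=> -[e /= e0 h]; have [n ne] := a_dense x e0.
by exists n; apply: h; rewrite /= metric_sym.
Qed.

(** The value does not depend on the chosen stage ([stick_fold_eq]), so that an
arbitrary choice yields a continuous map. *)
Definition stick_retraction y : Y :=
  if pselect (range i y) then y
  else i (stick_fold (xget 0%N [set n | rho y (i (a n)) < 2 * delta y]) y).

Lemma stick_retraction_out n y : ~ range i y ->
  rho y (i (a n)) < 2 * delta y -> stick_retraction y = i (stick_fold n y).
Proof.
move=> yi yn; rewrite /stick_retraction; case: pselect => //= nyi; congr i.
case: iP => _ _ ci; have d0 : 0 < delta y by exact: (dist_range_gt0 (a 0)).
case: xgetP => [k kE /= yk|/(_ n) //].
by apply: stick_fold_eq; apply: stick_weight1 => //; exact: ltW.
Qed.

Lemma stick_retraction_continuous : continuous stick_retraction.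
Proof.
case: iP => _ _ ci y; rewrite /continuous_at.
have [[x _ xy]|yi] := pselect (range i y).
- have -> : stick_retraction y = i x.
    by rewrite /stick_retraction; case: pselect => // -[]; exists x.
  move=> U /[dup] iU /embedding_continuous.
  rewrite nbhs_filterE -metricType_numDomainType.filter_from_mdist_nbhs.
  move=> -[e /= e0 eU]; have [h h0 hP] := embedding_inv x e0.
  have /(metrizes_near rhoP)[h' h'0 h'U] := iU.
  apply/(metrizes_near rhoP); rewrite -xy.
  (* For [z] within [h / 4] of [i x], the distance of [z] to the range is at
     most [h / 4]; the points [i (a k)] that are used lie within [3 h / 4] of
     [z], hence within [h] of [i x]. *)
  exists (Num.min h' (h / 4)) => [|z /= ]; first by rewrite lt_min h'0; lra.
  rewrite lt_min => /andP[zh' zh].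
  have [zi|zi] := pselect (range i z).
    by rewrite /stick_retraction; case: pselect => //= _; exact: h'U.
  have d0 : 0 < delta z by exact: (dist_range_gt0 (a 0)).
  have [n zn] := stick_stop zi; rewrite (stick_retraction_out zi zn).
  apply: eU; apply: stick_fold_ball d0 _ (stick_weight1 d0 (ltW zn)) => k zk.
  apply: hP; case: rhoP => _ rhoC /(_ (i x) z (i (a k))) + _.
  have := dist_range_le i (a 0) rhoP z x; rewrite -/delta (rhoC z); lra.
- have d0 : 0 < delta y by exact: (dist_range_gt0 (a 0)).
  have [n yn] := stick_stop yi.
  rewrite (stick_retraction_out yi yn).
  have : (i (stick_fold n z)) @[z --> y] --> i (stick_fold n y).
    apply: (@cvg_comp _ _ _ (stick_fold n) i);
      [exact: stick_fold_continuous | exact: embedding_continuous].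
  (* The stage that stops the process at [y] also stops it near [y]. *)
  apply: cvg_trans; apply: near_eq_cvg.
  have n1 : \forall z \near y, ~ range i z.
    by apply: open_nbhs_nbhs; split=> //; exact: closed_openC.
  have n2 : \forall z \near y, 0 < 2 * delta z - rho z (i (a n)).
    apply: (@cvgr_gt _ _ (nbhs y) _ _ (2 * delta y - rho y (i (a n)))).
      apply: cvgB; last exact: metrizes_dist_continuous.
      by apply: cvgM; [exact: cvg_cst | exact: (dist_range_continuous (a 0))].
    by rewrite subr_gt0.
  near=> z; rewrite (@stick_retraction_out n)//; first by near: z.
  by rewrite -subr_gt0; near: z.
Unshelve. all: by end_near. Qed.

End stick_breaking.

(** A Dugundji-type theorem: the points [m x y p] play the part of convex
combinations, and the stability of balls that of local convexity. *)
Theorem stick_breaking_absolute_retract {R : realType} {X : metricType R}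
    (a : nat -> X) (m : X -> X -> R -> X) :
  (forall x (e : R), 0 < e -> exists n, mdist (a n) x < e) ->
  continuous (fun q : X * X * R => m q.1.1 q.1.2 q.2) ->
  (forall x y, m x y 0 = x) -> (forall x y, m x y 1 = y) ->
  (forall x y z p (e : R),
    mdist z x < e -> mdist z y < e -> mdist z (m x y p) < e) ->
  absolute_retract R X.
Proof.
move=> a_dense m_cont m0 m1 m_ball; split.
  by exists (@mdist R X); exact: metrizes_mdist.
move=> Y i [rho rhoP] iP; exists (stick_retraction a m i rho); split.
- exact: stick_retraction_continuous.
- move=> _ [y _ <-]; rewrite /stick_retraction.
  by case: pselect => //= _; eexists.
- by move=> y yi; rewrite /stick_retraction; case: pselect.
Qed.

(** * Metric subspaces and the Hausdorff distance *)

Section set_type_metric.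
Context {R : realType} (X : metricType R) (A : set X).

Let dist (x y : A) : R := mdist (val x) (val y).

Let dist_ge0 x y : 0 <= dist x y. Proof. exact: mdist_ge0. Qed.

Let dist_positivity x y : dist x y = 0 -> x = y.
Proof. by move/mdist_positivity/val_inj. Qed.

Let ballEdist (x : A) (e : R) : ball x e = [set y | dist x y < e].
Proof. by rewrite -initial_ballE /preimage /= ballEmdist. Qed.

HB.instance Definition _ := PseudoMetric_isMetric.Build R (A : Type)
  dist_ge0 dist_positivity ballEdist.

End set_type_metric.

Section hausdorff.
Context {R : realType} {M : metricType R}.
Implicit Types A B : compacts M.

Lemma hausdorff_le A B (e : R) : 0 <= e ->
  (forall a, compacts_set A a -> exists2 b, compacts_set B b & mdist a b <= e) ->
  (forall b, compacts_set B b -> exists2 a, compacts_set A a & mdist a b <= e) ->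
  mdist A B <= e.
Proof. by move=> e0 AB BA; apply: ge_inf => //; exists 0 => t []. Qed.

Let compacts_bounded A (x : M) :
  exists r : R, forall a, compacts_set A a -> mdist a x <= r.
Proof.
have c : continuous (fun a => mdist a x : R^o).
  move=> a; apply/cvgrPdist_lt => e e0.
  apply/(metrizes_near (metrizes_mdist M)); exists e => // b /= ab.
  rewrite ltr_norml.
  have := metric_triangle a b x; have := metric_triangle b a x.
  by rewrite (metric_sym b a); lra.
have /compact_bounded[r [_ rP]] :=
  continuous_compact (continuous_subspaceT c) (compacts_compact (c := A)).
exists (r + 1) => a Aa; apply: le_trans (ler_norm _) _.
by apply: (rP (r + 1)); [rewrite ltrDl | exists a].
Qed.

(** Boundedness makes the infimum defining the distance that of a nonempty set;
the infimum of the empty set would be 0. *)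
Lemma hausdorff_lt A B (e : R) : mdist A B < e ->
  (forall a, compacts_set A a -> exists2 b, compacts_set B b & mdist a b < e) /\
  (forall b, compacts_set B b -> exists2 a, compacts_set A a & mdist a b < e).
Proof.
move=> /inf_lt[|d [_ AB BA] de].
  have [a Aa] := compacts_neq0 A; have [b Bb] := compacts_neq0 B.
  have [r rP] := compacts_bounded A b; have [s sP] := compacts_bounded B a.
  exists (Num.max r s); split=> [|a' /rP ?|b' /sP ?].
  - by rewrite le_max (le_trans (mdist_ge0 a b) (rP _ Aa)).
  - by exists b; rewrite // le_max; apply/orP; left.
  - by exists a; rewrite // metric_sym le_max; apply/orP; right.
split=> [a /AB[b Bb ab]|b /BA[a Aa ab]].
  by exists b => //; exact: le_lt_trans ab de.
by exists a => //; exact: le_lt_trans ab de.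
Qed.

End hausdorff.

Lemma separable_sequence {R : realType} (X : metricType R) (x0 : X) :
  separable X -> exists a : nat -> X,
    forall x (e : R), 0 < e -> exists n, mdist (a n) x < e.
Proof.
move=> [D /countable_injP[g gi] dD].
exists (fun n => xget x0 [set x | D x /\ g x = n]) => x e e0.
have [y [/= + Dy]] : (ball x e)^° `&` D !=set0.
  apply: dD; last exact: open_interior.
  by exists x; exact: nbhsx_ballx.
move=> /interior_subset; rewrite ballEmdist /= => xy.
exists (g y); case: xgetP => [z _ [Dz /gi zy]|/(_ y)[]//].
by rewrite zy ?inE// metric_sym.
Qed.

(** * Dense sequences of compact sets *)

Section compacts_separable.
Context {R : realType} {M : metricType R}.
Variable a : nat -> M.
Hypothesis a_dense : forall x (e : R), 0 < e -> exists n, mdist (a n) x < e.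

Definition is_net (s : seq nat) (e : R) (C : set M) :=
  (forall c, C c -> exists2 j, j \in s & mdist c (a j) < e) /\
  (forall j, j \in s -> exists2 c, C c & mdist c (a j) < e).

Lemma compact_net (C : set M) e : compact C -> 0 < e -> exists s, is_net s e C.
Proof.
move=> /compact_near_coveringP/(_ nat \oo) cC e0.
have [|N _ NP] := cC (fun n c => exists2 j, (j < n)%N & mdist c (a j) < e) _.
  move=> c _; have e20 : 0 < e / 2 by rewrite divr_gt0.
  have [j jc] := a_dense c e20.
  exists (ball c (e / 2), [set n | (j < n)%N]).
    by split; [exact: nbhsx_ballx | exists j.+1].
  move=> [b n] /= []; rewrite ballEmdist /= => cb jn; exists j => //.
  by have := metric_triangle b c (a j);
    rewrite (metric_sym b c) (metric_sym c (a j)); lra.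
exists [seq j <- iota 0 N | `[< exists2 c, C c & mdist c (a j) < e >]].
split=> [c Cc|j].
  have [j jN cj] := NP N (leqnn N) c Cc; exists j => //.
  rewrite mem_filter mem_iota /= add0n jN andbT.
  by apply/asboolP; exists c.
by rewrite mem_filter => /andP[/asboolP].
Qed.

Lemma net_hausdorff s e (C D : compacts M) :
  0 < e -> is_net s e C -> is_net s e D -> mdist C D <= 2 * e.
Proof.
move=> e0 [C1 C2] [D1 D2]; apply: hausdorff_le; first by lra.
  move=> c /C1[j /D2[d Dd dj] cj]; exists d => //.
  by have := metric_triangle c (a j) d; rewrite (metric_sym (a j)); lra.
move=> d /D1[j /C2[c Cc cj] dj]; exists c => //.
by have := metric_triangle c (a j) d; rewrite (metric_sym (a j)); lra.
Qed.

(** Compact sets with the same finite [e]-net are [2 e]-close, so it is enough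
to choose one element of [P] for each pair of a net and a precision that is
realized in [P]: this gives a sequence in [P] itself, whereas finite sets need
not belong to [P]. *)
Lemma compacts_dense_sequence (P : set (compacts M)) (C0 : P) :
  exists b : nat -> P, forall C (e : R), 0 < e -> exists n, mdist (b n) C < e.
Proof.
pose b n : P := if unpickle n is Some (s, k)
  then xget C0 [set C : P | is_net s k.+1%:R^-1 (compacts_set (val C))] else C0.
exists b => C e e0.
have [k ke] : exists k, 2 * k.+1%:R^-1 < e :> R.
  have e20 : 0 < e / 2 by rewrite divr_gt0.
  have [k _ /(_ _ (leqnn _)) /= kP] := near_infty_natSinv_lt (PosNum e20).
  by exists k; rewrite mulrC -ltr_pdivlMr.
have k0 : 0 < k.+1%:R^-1 :> R by rewrite invr_gt0.
have [s sC] := compact_net (compacts_compact (c := val C)) k0.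
exists (pickle (s, k)); rewrite /b pickleK; apply: le_lt_trans ke.
case: xgetP => [D _ sD|/(_ C)//]; exact: net_hausdorff sD sC.
Qed.

End compacts_separable.

(** * Weighted joins in a Riesz space *)

Section riesz_joins.
Context {R : realType} {E : rieszType R}.
Implicit Types (x y z w u : E).

(** The tool for identities between joins: an element is determined by its upper
bounds, and those of a join are the common upper bounds of its terms. *)
Lemma riesz_eq_le x y : (forall w, (x <= w) = (y <= w)) -> x = y.
Proof. by move=> xy; apply/le_anti; rewrite xy lexx -xy lexx. Qed.

Lemma riesz_leDr x z w : (x + z <= w) = (x <= w - z).
Proof. by rewrite (riesz_leB (x + z)) (riesz_leB x) opprD addrA addrAC. Qed.

Lemma big_rjoin_le (m : nat) (x0 : E) (f : 'I_m -> E) w :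
  (\big[rjoin/x0]_(i < m) f i <= w) <-> x0 <= w /\ forall i, f i <= w.
Proof.
elim: m f => [|m IH] f.
  by rewrite big_ord0; split=> [? |[]//]; split=> // -[].
rewrite big_ord_recl rjoin_le; split.
  move=> /andP[f0 /IH[x0w fw]]; split=> // i.
  by have [j ->|->] := unliftP ord0 i.
by move=> [x0w fw]; rewrite fw /=; apply/IH.
Qed.

End riesz_joins.

Section mp_mix.
Context {R : realType} {E : rieszType R} {u : E}.
Hypothesis unit_u : riesz_unit u.
Implicit Types (x y z w : E) (C D : set E).

Let le_scale_unit (s t : R) : s <= t -> s *: u <= t *: u.
Proof.
by move=> st; rewrite riesz_leB -scalerBl riesz_scale_ge0 ?subr_ge0//;
  case: unit_u.
Qed.

Definition mp_mix (s t : R) (q : E * E) : E :=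
  rjoin (q.1 + s *: u) (q.2 + t *: u).

Lemma mp_mix_le s t q w :
  (mp_mix s t q <= w) = (q.1 <= w - s *: u) && (q.2 <= w - t *: u).
Proof. by rewrite /mp_mix rjoin_le !riesz_leDr. Qed.

Lemma mp_mix_idem s t x : Num.max s t = 0 -> mp_mix s t (x, x) = x.
Proof.
move=> st; apply: riesz_eq_le => w; rewrite mp_mix_le /=.
have h (r : R) : r <= 0 -> x <= w -> x <= w - r *: u.
  move=> r0 xw; rewrite -riesz_leDr; apply: le_trans xw.
  rewrite -[leRHS]addr0 -(scale0r u).
  by apply: riesz_leD => //; exact: le_scale_unit.
have s0 : s <= 0 by rewrite -st le_max lexx.
have t0 : t <= 0 by rewrite -st le_max lexx orbT.
apply/andP/idP => [[xs xt]|xw]; last by split; exact: h.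
by move: st xs xt; rewrite /Num.max; case: ifP => _ ->; rewrite scale0r subr0.
Qed.

(** Absorption: a term that is low enough leaves no trace in the join. This is why
finite weights suffice to reach the two ends of [slide]. *)
Lemma mp_mix_fst s t x y : s = 0 -> y + t *: u <= x -> mp_mix s t (x, y) = x.
Proof.
move=> -> yx; apply: riesz_eq_le => w; rewrite mp_mix_le /= scale0r subr0.
by apply: andb_idr => xw; rewrite -riesz_leDr; exact: le_trans xw.
Qed.

Lemma mp_mix_snd s t x y : t = 0 -> x + s *: u <= y -> mp_mix s t (x, y) = y.
Proof.
move=> -> xy; apply: riesz_eq_le => w; rewrite mp_mix_le /= scale0r subr0.
by apply: andb_idl => yw; rewrite -riesz_leDr; exact: le_trans yw.
Qed.

Lemma mp_convex_mix C s t x y : mp_convex u C -> Num.max s t = 0 ->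
  C x -> C y -> C (mp_mix s t (x, y)).
Proof.
move=> cC st Cx Cy; rewrite cC.
exists 1%N, (fun i => if i == ord0 then x else y),
  (fun i => if i == ord0 then s else t); split.
- by move=> i; case: ifP.
- by rewrite !big_ord_recl big_ord0 /= [Num.max t s]maxC maxA maxxx.
- rewrite !big_ord_recl big_ord0 /= /mp_mix /=; apply: riesz_eq_le => w.
  by rewrite !rjoin_le [RHS]andbCA andbb andbC.
Qed.

Lemma sub_mp_hull C : C `<=` mp_hull u C.
Proof.
move=> x Cx; exists 0%N, (fun=> x), (fun=> 0); split=> //.
  by rewrite big_ord_recl big_ord0 maxxx.
rewrite big_ord_recl big_ord0 scale0r addr0; apply: riesz_eq_le => w.
by rewrite rjoin_le andbb.
Qed.

Lemma mp_convex_set1 y : mp_convex u [set y].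
Proof.
apply/seteqP; split; first exact: sub_mp_hull.
move=> z [m [x [r [xP r0 ->]]]] /=; apply: riesz_eq_le => w.
have xE i : x i = y by exact: xP.
have r_le0 i : r i <= 0 by rewrite -r0; exact: le_bigmax.
(* The term of weight 0 bounds the join from below by [y], the others do not
   exceed [y] because their weights are nonpositive. *)
have [i ri] : exists i, r i = 0.
  apply: contrapT => no0; have r_lt0 i : r i < 0.
    by rewrite lt_neqAle r_le0 andbT; apply/eqP => ri; apply: no0; exists i.
  have := bigmax_lt (index_enum _) (r_lt0 ord0) (fun i (_ : true) => r_lt0 i).
  by rewrite r0 ltxx.
apply/idP/idP => [/big_rjoin_le[_ /(_ i)]|yw].
  by rewrite ri xE scale0r addr0.
have h j : x j + r j *: u <= w.
  rewrite xE -[leRHS]addr0 -(scale0r u).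
  by apply: riesz_leD yw _; exact: le_scale_unit.
exact/big_rjoin_le.
Qed.

(** Joins commute with joins and with translations: a combination with weights
[r i] of mixtures of [x i] and [y i] is the mixture of the combinations of the
[x i] and of the [y i] with these weights. *)
Lemma mp_convex_image_mix C D s t : mp_convex u C -> mp_convex u D ->
  mp_convex u (mp_mix s t @` (C `*` D)).
Proof.
move=> cC cD; apply/seteqP; split; first exact: sub_mp_hull.
move=> z [m [x [r [xP r0 ->]]]].
have /choice[q qP] : forall i, exists q : E * E,
    (C `*` D) q /\ mp_mix s t q = x i by move=> i; case: (xP i) => q; exists q.
exists (\big[rjoin/(q ord0).1 + r ord0 *: u]_(i < m.+1) ((q i).1 + r i *: u),
        \big[rjoin/(q ord0).2 + r ord0 *: u]_(i < m.+1) ((q i).2 + r i *: u)).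
  split=> /=.
    rewrite cC; exists m, (fun i => (q i).1), r; split=> // i.
    by case: (qP i) => -[].
  rewrite cD; exists m, (fun i => (q i).2), r; split=> // i.
  by case: (qP i) => -[].
apply: riesz_eq_le => w; rewrite mp_mix_le /=.
have e i : (x i + r i *: u <= w) =
    ((q i).1 + r i *: u <= w - s *: u) && ((q i).2 + r i *: u <= w - t *: u).
  have [_ <-] := qP i; rewrite [LHS]riesz_leDr mp_mix_le.
  by rewrite !riesz_leDr (addrAC w (- (s *: u))) (addrAC w (- (t *: u))).
apply/andP/idP => [[/big_rjoin_le[_ h1] /big_rjoin_le[_ h2]]|].
  by apply/big_rjoin_le; split=> [|i]; rewrite e h1 h2.
move=> /big_rjoin_le[_ h]; have {}h i := h i; split; apply/big_rjoin_le.
  by split=> [|i]; [have := h ord0 | have := h i]; rewrite e => /andP[].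
by split=> [|i]; [have := h ord0 | have := h i]; rewrite e => /andP[].
Qed.

End mp_mix.

(** * Mixing compact max-plus convex sets *)

Section mp_mix_hyperspace.
Context {R : realType} {E : rieszType R} {u : E}.
Variables (archE : archimedean E) (unit_u : riesz_unit u).
Local Notation Eu := (unorm_space archE unit_u).
Local Notation M := (MPCC archE unit_u).
Implicit Types (x y : Eu) (C D : M) (s t e : R).

Lemma unorm_dist_lt x y e : mdist x y < e -> x <= y + e *: u.
Proof.
move=> /(unorm_lt unit_u); rewrite riesz_abs_le => /andP[+ _].
by rewrite riesz_leDr opprK addrC.
Qed.

Lemma unorm_dist_le x y e : 0 <= e ->
  x <= y + e *: u -> y <= x + e *: u -> mdist x y <= e.
Proof.
move=> e0 xy yx; apply: (unorm_le unit_u e0); rewrite riesz_abs_le opprB.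
by rewrite !riesz_leDr !opprK !(addrC (e *: u)) xy.
Qed.

(** Nonexpansiveness with the maximum of the two distances, not their sum: the
stability of balls depends on it. *)
Lemma mp_mix_dist s t x x' y y' e : mdist x x' < e -> mdist y y' < e ->
  mdist (mp_mix (u := u) s t (x, y) : Eu) (mp_mix (u := u) s t (x', y')) <= e.
Proof.
have h (a a' b b' : Eu) : mdist a a' < e -> mdist b b' < e ->
    mp_mix (u := u) s t (a, b) <= mp_mix (u := u) s t (a', b') + e *: u.
  move=> /unorm_dist_lt aa /unorm_dist_lt bb; rewrite mp_mix_le /=.
  have [] : mp_mix (u := u) s t (a', b') <= mp_mix (u := u) s t (a', b') by [].
  rewrite mp_mix_le /= => /andP[a1 b1].
  rewrite !(addrAC _ (e *: u)) (le_trans aa) ?(le_trans bb)//;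
    exact: riesz_leD2r.
move=> xx yy; apply: unorm_dist_le; [|exact: h|].
  exact: le_trans (mdist_ge0 x x') (ltW xx).
by apply: h; rewrite metric_sym.
Qed.

Lemma unorm_unit_le1 : `|u : Eu| <= 1.
Proof.
apply: (unorm_le unit_u ler01); rewrite scale1r riesz_abs_le lexx /=.
case: unit_u => u0 _; apply: le_trans u0.
by rewrite riesz_leB sub0r opprK; case: unit_u.
Qed.

Lemma mp_mix_dist_weight s t s' t' x x' y y' e d :
  mdist x x' < e -> mdist y y' < e -> `|s - s'| < d -> `|t - t'| < d ->
  mdist (mp_mix (u := u) s t (x, y) : Eu) (mp_mix (u := u) s' t' (x', y'))
    <= e + d.
Proof.
have h (a a' : Eu) (r r' : R) : mdist a a' < e -> `|r - r'| < d ->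
    mdist (a + r *: (u : Eu)) (a' + r' *: (u : Eu)) < e + d.
  move=> aa rr; rewrite /mdist /= opprD addrACA -scalerBl.
  apply: le_lt_trans (ler_normD _ _) _; apply: ltr_leD => //.
  rewrite normrZ; apply: le_trans (ltW rr).
  by rewrite ler_piMr// unorm_unit_le1.
move=> xx yy ss tt.
(* The weights are moved into the points, so that a change of weight becomes a
   displacement along [u]. *)
have := @mp_mix_dist 0 0 _ _ _ _ _ (h _ _ _ _ xx ss) (h _ _ _ _ yy tt).
by rewrite /mp_mix /= !scale0r !addr0.
Qed.

Lemma mp_mix_continuous s t :
  continuous (mp_mix (u := u) s t : Eu * Eu -> Eu).
Proof.
move=> [x y]; apply/metricType_numDomainType.cvgrPdist_le => e e0.
exists (ball x e, ball y e); first by split; exact: nbhsx_ballx.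
by move=> [x' y'] [] /=; rewrite !ballEmdist => xx yy; exact: mp_mix_dist.
Qed.

Lemma compact_image_mix s t (C D : compacts Eu) :
  compact (mp_mix (u := u) s t @` (compacts_set C `*` compacts_set D)
    : set Eu).
Proof.
apply: continuous_compact; last by apply: compact_setX; exact: compacts_compact.
by apply: continuous_subspaceT; exact: mp_mix_continuous.
Qed.

Lemma image_mix_neq0 s t (C D : compacts Eu) :
  (mp_mix (u := u) s t @` (compacts_set C `*` compacts_set D) : set Eu) !=set0.
Proof.
have [x Cx] := compacts_neq0 C; have [y Dy] := compacts_neq0 D.
by exists (mp_mix (u := u) s t (x, y)), (x, y).
Qed.

Definition compact_mix s t (C D : compacts Eu) : compacts Eu :=
  Compacts (@compact_image_mix s t C D) (image_mix_neq0 s t C D).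

Lemma compact_mix_convex s t C D : compact_mix s t (val C) (val D) \in M.
Proof.
rewrite inE; apply: mp_convex_image_mix; first exact: set_mem (valP C).
exact: set_mem (valP D).
Qed.

Definition hyper_mix s t C D : M :=
  exist (fun B => B \in M) _ (compact_mix_convex s t C D).

Lemma hyper_mix_fst s t C D : s = 0 ->
  (forall x y, compacts_set (val C) x -> compacts_set (val D) y ->
    y + t *: u <= x) ->
  hyper_mix s t C D = C.
Proof.
move=> s0 CD; apply/val_inj/compacts_inj => /=; apply/seteqP; split.
  by move=> _ [[x y] [/= Cx Dy] <-]; rewrite mp_mix_fst//; exact: CD.
move=> x Cx; have [y Dy] := compacts_neq0 (val D).
by exists (x, y) => //; rewrite mp_mix_fst//; exact: CD.
Qed.

Lemma hyper_mix_snd s t C D : t = 0 ->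
  (forall x y, compacts_set (val C) x -> compacts_set (val D) y ->
    x + s *: u <= y) ->
  hyper_mix s t C D = D.
Proof.
move=> s0 CD; apply/val_inj/compacts_inj => /=; apply/seteqP; split.
  by move=> _ [[x y] [/= Cx Dy] <-]; rewrite mp_mix_snd//; exact: CD.
move=> y Dy; have [x Cx] := compacts_neq0 (val C).
by exists (x, y) => //; rewrite mp_mix_snd//; exact: CD.
Qed.

Lemma hyper_mix_dist s t s' t' C C' D D' e d :
  mdist C C' < e -> mdist D D' < e -> `|s - s'| < d -> `|t - t'| < d ->
  mdist (hyper_mix s t C D) (hyper_mix s' t' C' D') <= e + d.
Proof.
move=> CC DD ss tt; have [C1 C2] := hausdorff_lt CC.
have [D1 D2] := hausdorff_lt DD.
apply: hausdorff_le.
- rewrite addr_ge0 ?(le_trans (mdist_ge0 C C') (ltW CC))//.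
  exact: le_trans (ltW ss).
- move=> _ [[x y] [/= /C1[x' Cx' xx] /D1[y' Dy' yy]] <-].
  by exists (mp_mix (u := u) s' t' (x', y'));
    [exists (x', y') | exact: mp_mix_dist_weight].
- move=> _ [[x y] [/= /C2[x' Cx' xx] /D2[y' Dy' yy]] <-].
  by exists (mp_mix (u := u) s t (x', y'));
    [exists (x', y') | exact: mp_mix_dist_weight].
Qed.

(** A point [b] of [B] is the mixture of [b] with itself, and mixtures of two
points of [B] are in [B]; replacing points of [B] by nearby points of [C] and
[D], or conversely, costs no more than their distance. *)
Lemma hyper_mix_ball s t B C D e : Num.max s t = 0 ->
  mdist B C < e -> mdist B D < e -> mdist B (hyper_mix s t C D) < e.
Proof.
move=> st BC BD.
(* Passing to pairs of points loses the strictness of the inequalities, hence a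
   radius strictly between the given distances and [e]. *)
pose d := (Num.max (mdist B C) (mdist B D) + e) / 2.
have [BCd BDd de] : [/\ mdist B C < d, mdist B D < d & d < e].
  have : Num.max (mdist B C) (mdist B D) < e by rewrite gt_max BC.
  have : mdist B C <= Num.max (mdist B C) (mdist B D) by rewrite le_max lexx.
  have : mdist B D <= Num.max (mdist B C) (mdist B D).
    by rewrite le_max lexx orbT.
  by rewrite /d; split; lra.
apply: le_lt_trans de; have [C1 C2] := hausdorff_lt BCd.
have [D1 D2] := hausdorff_lt BDd.
have cB : mp_convex u (compacts_set (val B)) by exact: set_mem (valP B).
apply: hausdorff_le.
- exact: le_trans (mdist_ge0 B C) (ltW BCd).
- move=> b Bb; have [x Cx bx] := C1 b Bb; have [y Dy by_] := D1 b Bb.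
  exists (mp_mix (u := u) s t (x, y)); first by exists (x, y).
  by rewrite -[X in mdist X _](mp_mix_idem unit_u b st); exact: mp_mix_dist.
- move=> _ [[x y] [/= /C2[b Bb bx] /D2[b' Bb' by_]] <-].
  exists (mp_mix (u := u) s t (b, b')); first exact: mp_convex_mix.
  exact: mp_mix_dist.
Qed.

Definition zero_compact : compacts Eu :=
  Compacts (@compact_set1 _ (0 : Eu)) (ex_intro _ (0 : Eu) erefl).

Lemma zero_compact_convex : zero_compact \in M.
Proof. by rewrite inE; exact: mp_convex_set1. Qed.

Definition zero_hyper : M := exist (fun B => B \in M) _ zero_compact_convex.

(** A bound for the distances between points of [C] and points of [D] that
depends continuously on [C] and [D]: the triangle inequality through 0. The
constant 1 makes the bound strict. *)
Definition reach C D : R := mdist C zero_hyper + mdist D zero_hyper + 1.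

Lemma reach_le C D x y : compacts_set (val C) x -> compacts_set (val D) y ->
  x - reach C D *: u <= y.
Proof.
move=> Cx Dy.
have h (B : M) b : compacts_set (val B) b ->
    mdist b (0 : Eu) < mdist B zero_hyper + 2^-1.
  have /hausdorff_lt[+ _] :
    mdist B zero_hyper < mdist B zero_hyper + 2^-1 by lra.
  by move=> /[apply] -[_ ->].
have /unorm_dist_lt : mdist x y < reach C D.
  have := metric_triangle x (0 : Eu) y; rewrite (metric_sym (0 : Eu)).
  by have := h _ _ Cx; have := h _ _ Dy; rewrite /reach; lra.
by rewrite riesz_leDr opprK.
Qed.

(** As [p] goes from 0 to 1, [r] goes from [- reach C D] to [reach C D]: the
weight of [D] first increases to 0, then that of [C] decreases from 0, and the
larger of the two weights is always 0. *)
Definition slide C D (p : R) : M :=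
  let r := (2 * p - 1) * reach C D in
  hyper_mix (Num.min 0 (- r)) (Num.min 0 r) C D.

Lemma reach_ge0 C D : 0 <= reach C D.
Proof. by rewrite /reach !addr_ge0// mdist_ge0. Qed.

Lemma slide0 C D : slide C D 0 = C.
Proof.
rewrite /slide mulr0 sub0r mulN1r opprK.
rewrite min_l ?reach_ge0// min_r ?oppr_le0 ?reach_ge0//.
have -> : reach C D = reach D C by rewrite /reach [X in X + 1]addrC.
by apply: hyper_mix_fst => // x y Cx Dy; rewrite scaleNr; exact: reach_le.
Qed.

Lemma slide1 C D : slide C D 1 = D.
Proof.
rewrite /slide; have -> : (2 * 1 - 1) * reach C D = reach C D by ring.
rewrite min_r ?oppr_le0 ?reach_ge0// min_l ?reach_ge0//.
by apply: hyper_mix_snd => // x y Cx Dy; rewrite scaleNr; exact: reach_le.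
Qed.

Lemma slide_ball B C D p e :
  mdist B C < e -> mdist B D < e -> mdist B (slide C D p) < e.
Proof.
apply: hyper_mix_ball; move: ((2 * p - 1) * _) => r.
have [r0|r0] := leP 0 r.
  by rewrite min_r ?oppr_le0// max_r// oppr_le0.
by rewrite min_l ?oppr_ge0 ?(ltW r0)// max_l// ltW.
Qed.

Lemma cvg_slide (T : Type) (F : set_system T) (FF : Filter F)
    (f g : T -> M) (p : T -> R) C D (r : R) :
  f @ F --> C -> g @ F --> D -> p @ F --> r ->
  slide (f a) (g a) (p a) @[a --> F] --> slide C D r.
Proof.
move=> fC gD pr.
have dist_cvg (h : T -> M) B : h @ F --> B ->
    mdist (h a) zero_hyper @[a --> F] --> (mdist B zero_hyper : R).
  move=> hB.
  apply: (@cvg_comp _ _ _ h (fun A => mdist A zero_hyper) _ (nbhs B)).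
    exact: hB.
  exact: (@metrizes_dist_continuous R M _ (@metrizes_mdist R M)).
pose w a := (2 * p a - 1) * reach (f a) (g a).
pose w0 := (2 * r - 1) * reach C D.
have wc : w a @[a --> F] --> w0.
  apply: cvgM; first by apply: cvgB; [apply: cvgMr | exact: cvg_cst].
  by apply: cvgD; [apply: cvgD; exact: dist_cvg | exact: cvg_cst].
have min_cvg (h : T -> R) (l : R) : h a @[a --> F] --> l ->
    Num.min 0 (h a) @[a --> F] --> Num.min 0 l.
  move=> hl; apply: (@cvg_comp _ _ _ h (Num.min 0) _ (nbhs l)); first exact: hl.
  by apply: (@continuous_min _ _ (fun=> 0) id); [exact: cvg_cst | exact: cvg_id].
have e_near (h : T -> R) (l e : R) : 0 < e -> h a @[a --> F] --> l ->
    \forall a \near F, `|l - h a| < e.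
  by move=> e0 hl; exact: (cvgr_dist_lt _ _ hl).
apply/metricType_numDomainType.cvgrPdist_le => e e0.
have e20 : 0 < e / 2 by rewrite divr_gt0.
near=> a; rewrite (splitr e); apply: hyper_mix_dist; near: a.
- exact: (metricType_numDomainType.cvgr_dist_lt fC e20).
- exact: (metricType_numDomainType.cvgr_dist_lt gD e20).
- by apply: e_near => //; apply: min_cvg; exact: cvgN.
- by apply: e_near => //; exact: min_cvg.
Unshelve. all: by end_near. Qed.

Lemma slide_continuous :
  continuous (fun q : M * M * R => slide q.1.1 q.1.2 q.2).
Proof.
move=> q; apply: cvg_slide; last exact: cvg_snd.
  by apply: cvg_comp; exact: cvg_fst.
by apply: cvg_comp; [exact: cvg_fst | exact: cvg_snd].
Qed.

End mp_mix_hyperspace.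

Theorem proposition8 (R : realType) (E : rieszType R) (u : E)
    (E_neq0 : exists x : E, x != 0)
    (archE : archimedean E) (unit_u : riesz_unit u)
    (complete_E : complete_space (unorm_space archE unit_u))
    (separable_E : separable (unorm_space archE unit_u)) :
  absolute_retract R (MPCC archE unit_u).
Proof.
have [a a_dense] :=
  separable_sequence (0 : unorm_space archE unit_u) separable_E.
have [b b_dense] := compacts_dense_sequence a_dense (zero_hyper archE unit_u).
apply: (@stick_breaking_absolute_retract R (MPCC archE unit_u) b
  (@slide _ _ _ archE unit_u) b_dense).
- exact: slide_continuous.
- exact: slide0.
- exact: slide1.
- by move=> C D B p e; exact: slide_ball.
Qed.
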